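(* Let $y:\mathbb{N}_0\to\mathbb{R}$ be a function. Fix $\nu\in(0,1)$ and suppose that $$\nabla_{-1}^{\nu}y(t)\ge 0\quad\text{for each } t\in\mathbb{N}_0.$$ Then $y$ is $\nu$-increasing on $\mathbb{N}_0$.
   Context: For a real number $c$, $\mathbb{N}_c=\{c,c+1,c+2,\dots\}$. $\nabla y(t)=y(t)-y(t-1)$, $\rho(s)=s-1$. The rising function is $x^{\overline{\beta}}=\Gamma(x+\beta)/\Gamma(x)$. The nabla left fractional sum of order $\beta>0$ starting from $c$ is $\nabla_c^{-\beta}y(t)=\frac{1}{\Gamma(\beta)}\sum_{s=c+1}^{t}(t-\rho(s))^{\overline{\beta-1}}y(s)$, with empty sums equal to $0$. For $0<\nu<1$ the nabla left (Riemann) fractional difference is $\nabla_c^{\nu}y(t)=\nabla\nabla_c^{-(1-\nu)}y(t)$ for $t\in\mathbb{N}_{c+1}$; equivalently, $\nabla_c^{\nu}y(t)=\frac{1}{\Gamma(-\nu)}\sum_{s=c+1}^{t}(t-\rho(s))^{\overline{-\nu-1}}y(s)$. Here $c=-1$. A function $y:\mathbb{N}_0\to\mathbb{R}$ satisfying $y(0)\ge 0$ is called $\nu$-increasing on $\mathbb{N}_0$ if $y(t+1)\ge\nu\,y(t)$ for all $t\in\mathbb{N}_0$. *)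

(* Defs.v *)
From HB Require Import structures.
From mathcomp Require Import all_boot all_order all_algebra.
From mathcomp Require Import all_classical all_reals all_analysis.
Set Implicit Arguments.
Unset Strict Implicit.
Unset Printing Implicit Defensive.
Import Order.TTheory GRing.Theory Num.Theory.
Import numFieldNormedType.Exports.
Local Open Scope ring_scope.

Definition Gamma_int (R : realType) (x : R) : R :=
  \int[@lebesgue_measure R]_(u in `]0, +oo[%classic) (u `^ (x - 1) * expR (- u)).

(* The integral is only used at positive arguments: truncn (1 - x) is 0 for
   x > 0, and for x <= 0 it is the least n with x + n > 0, so that the quotient
   is the continuation of the integral by Gamma (x + 1) = x Gamma x.  At the
   poles the value is 0, since division by 0 gives 0. *)
Definition Gamma (R : realType) (x : R) : R :=
  let n := Num.truncn (1 - x) in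
  Gamma_int (x + n%:R) / \prod_(i < n) (x + i%:R).

Definition rising (R : realType) (x b : R) : R := Gamma (x + b) / Gamma x.

Definition rho (s : int) : int := s - 1.

Definition nabla (R : realType) (f : int -> R) (t : int) : R :=
  f t - f (t - 1).

(* Time is int-valued and the base point c is an integer.  The sum over
   c + 1 <= s <= t is indexed by s = c + 1 + k with k < t - c; it is 0 when
   t <= c. *)
Definition nabla_sum (R : realType) (c : int) (b : R) (f : int -> R) (t : int)
    : R :=
  (Gamma b)^-1 *
  if t - c is Posz n then
    \sum_(k < n) let s := c + 1 + k%:Z in
      rising (t - rho s)%:~R (b - 1) * f s
  else 0.

Definition nabla_diff (R : realType) (c : int) (nu : R) (f : int -> R) :
    int -> R :=
  nabla (nabla_sum c (1 - nu) f).

(* nabla_sum (-1) and nabla_diff (-1) only evaluate their argument at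
   nonnegative integers, so the values at Negz are irrelevant there. *)
Definition on_int (R : realType) (y : nat -> R) (s : int) : R :=
  if s is Posz n then y n else 0.

Definition nu_increasing (R : realType) (nu : R) (y : nat -> R) : Prop :=
  0 <= y 0%N /\ forall t : nat, nu * y t <= y t.+1.

(* Main.v *)
(* By the functional equation of Gamma, the kernel of the fractional sum of
   order b = 1 - nu has coefficients w(0) = 1 and
   w(n+1) = w(n) (n + b)/(n + 1), so it is positive and nonincreasing, with
   w(1) - w(0) = - nu.  At time 0 the hypothesis is
   y(0) >= 0, and at t + 1 it reads
     y(t+1) - nu y(t) >= sum_(k < t) (w(t-k) - w(t+1-k)) y(k),
   and the right-hand side is nonnegative once y(0), ..., y(t-1) are; strong
   induction then gives y >= 0 and the conclusion together. *)
Require Import Defs.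
From mathcomp Require Import all_boot all_order all_algebra.
From mathcomp Require Import all_classical all_reals all_analysis.
From mathcomp Require Import measurable_realfun.
From mathcomp Require Import ring lra zify.
Import Order.TTheory GRing.Theory Num.Theory.
Import numFieldNormedType.Exports.
Local Open Scope classical_set_scope.
Local Open Scope ring_scope.

(** * The Gamma integral in the extended reals *)

Definition gamma_integrand {R : realType} (x u : R) : R :=
  u `^ (x - 1) * expR (- u).

(* Extended-real valued, so that integrability on ]0, +oo[ can be read off
   from the functional equation. *)
Definition egamma {R : realType} (x : R) : \bar R :=
  (\int[@lebesgue_measure R]_(u in `]0%R, +oo[%classic)
     (gamma_integrand x u)%:E)%E.

Lemma gamma_integrand_ge0 {R : realType} (x u : R) : 0 <= gamma_integrand x u.
Proof. by rewrite mulr_ge0 ?powR_ge0 ?expR_ge0. Qed.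

Lemma measurable_gamma_integrand {R : realType} (x : R) (D : set R) :
  measurable_fun D (fun u : R => (gamma_integrand x u)%:E).
Proof.
apply/measurable_EFinP/measurable_funTS; apply: measurable_funM => //.
by apply: measurableT_comp => //; exact: measurable_oppr.
Qed.

Lemma Gamma_fine {R : realType} (x : R) : 0 < x -> Gamma x = fine (egamma x).
Proof.
move=> x0; rewrite /Gamma.
have -> : Num.truncn (1 - x) = 0%N.
  by apply/truncn0Pn; rewrite -ltNge gtrBl.
by rewrite big_ord0 divr1 addr0.
Qed.

Lemma egamma_ge0 {R : realType} (x : R) : (0 <= egamma x)%E.
Proof. by apply: integral_ge0 => u _; rewrite lee_fin gamma_integrand_ge0. Qed.

(** * Value at 1 and functional equation *)

Lemma continuous_expRN {R : realType} : continuous (fun u : R => expR (- u)).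
Proof.
move=> u; apply: continuous_comp; last exact: continuous_expR.
exact: oppr_continuous.
Qed.

Lemma is_derive_NexpRN {R : realType} (u : R) :
  is_derive u 1 (fun v : R => - expR (- v)) (expR (- u)).
Proof. by apply: is_derive_eq; rewrite mulrN1 opprK. Qed.

Lemma egamma1 {R : realType} : egamma (1 : R) = 1%E.
Proof.
(* Adding the null point 0 makes the fundamental theorem of calculus on a closed half-line
   applicable. *)
rewrite /egamma integral_itv_obnd_cbnd; last exact: measurable_gamma_integrand.
under eq_integral do rewrite /gamma_integrand subrr powRr0 mul1r.
rewrite (@ge0_continuous_FTC2y R _ (fun u => - expR (- u)) _ 0).
- by rewrite oppr0 expR0 sub0e -EFinN opprK.
- by move=> u _; exact: expR_ge0.
- by apply: continuous_subspaceT; exact: continuous_expRN.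
- by rewrite -oppr0; apply: cvgN; exact: cvgr_expR.
- by move=> u _; exact: ex_derive.
- by apply: cvgN; apply/cvg_at_right_filter; exact: continuous_expRN.
- move=> u _; rewrite derive1E; have := is_derive_NexpRN u.
  by move=> ?; rewrite derive_val.
Qed.

(** Integration by parts with [u^x] and the antiderivative [- e^(-u)]. The interval stays away from
    0, where [u^x] and its derivative can be singular. *)
Lemma egamma_trunc_parts {R : realType} (x a b : R) :
    0 < x -> 0 < a -> a < b ->
  (\int[@lebesgue_measure R]_(u in `[a, b]) (gamma_integrand (x + 1) u)%:E =
   (a `^ x * expR (- a) - b `^ x * expR (- b))%:E + x%:E *
   \int[@lebesgue_measure R]_(u in `[a, b]) (gamma_integrand x u)%:E)%E.
Proof.
move=> x0 a0 ab.
have cpow y : {within `[a, b], continuous (fun u : R => u `^ y)}.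
  apply: derivable_within_continuous => u; rewrite in_itv/= => /andP[au _].
  by apply: derivable_powR; rewrite in_itv/= andbT (lt_le_trans a0).
have cpowLR y : derivable_oo_LRcontinuous (fun u : R => u `^ y) a b.
  have [_ cR cL] := (continuous_within_itvP _ ab).1 (cpow y).
  split => // u; rewrite in_itv/= => /andP[au _].
  by apply: derivable_powR; rewrite in_itv/= andbT (lt_trans a0).
under eq_integral do rewrite /gamma_integrand addrK.
rewrite (@integration_by_parts R _ (fun u => - expR (- u))
   (fun u => x * u `^ (x - 1)) _ a b)//; last 5 first.
- apply: derivable_within_continuous => u; rewrite in_itv/= => /andP[au _].
  apply: derivableM => //; apply: derivable_powR.
  by rewrite in_itv/= andbT (lt_le_trans a0).
- move=> u; rewrite in_itv/= => /andP[au _].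
  by apply: powR_derive1; rewrite in_itv/= andbT (lt_trans a0).
- by apply: continuous_subspaceT; exact: continuous_expRN.
- split.
  + by move=> u _; exact: ex_derive.
  + by apply: cvgN; apply/cvg_at_right_filter; exact: continuous_expRN.
  + by apply: cvgN; apply/cvg_at_left_filter; exact: continuous_expRN.
- move=> u _; rewrite derive1E; have := is_derive_NexpRN u.
  by move=> ?; rewrite derive_val.
under [X in (_ - X)%E]eq_integral do rewrite mulrN -mulrA EFinN EFinM.
have integrand_ge0 (u : R) : `[a, b]%classic u ->
    (0 <= (u `^ (x - 1) * expR (- u))%:E)%E.
  by move=> _; exact: gamma_integrand_ge0.
rewrite integral_ge0N; last first.
  by move=> u uab; rewrite mule_ge0 ?integrand_ge0// lee_fin ltW.
rewrite ge0_integralZl_EFin//; last 2 first.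
- exact: measurable_gamma_integrand.
- exact: ltW.
by rewrite oppeK; congr (_%:E + _)%E; ring.
Qed.

(** With an integer [m >= x], the term of degree [m + 1] of the exponential series bounds [e^N]
    below by [N^(m+1) / (m+1)!], so [N^x e^(-N) <= (m+1)! / N]. *)
Lemma powR_expRN_cvg0 {R : realType} (x : R) :
  (n.+2%:R `^ x * expR (- n.+2%:R)) @[n --> \oo] --> (0 : R).
Proof.
pose m := (Num.truncn x).+1.
apply: (@squeeze_cvgr _ _ _ _ (cst 0) (fun n => m.+1`!%:R * @harmonic R n)).
- near=> n; rewrite mulr_ge0 ?powR_ge0 ?expR_ge0//=.
  have n0 : 0 < n.+2%:R :> R by [].
  have expn : n.+2%:R ^+ m.+1 / m.+1`!%:R <= expR n.+2%:R :> R.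
    by apply: le_trans (expR_ge1Dxn m (ltW n0)); rewrite lerDr.
  have powx : n.+2%:R `^ x <= n.+2%:R ^+ m :> R.
    rewrite -powR_mulrn; last exact: ltW.
    by rewrite ler_powR ?ler1n// ltW// truncnS_gt.
  rewrite expRN ler_pdivrMr ?expR_gt0//.
  apply: le_trans powx _; rewrite mulrAC ler_pdivlMr//.
  move: expn; rewrite ler_pdivrMr ?ltr0n ?fact_gt0// mulrC.
  move=> /(le_trans _); apply.
  by rewrite exprSr ler_wpM2l ?exprn_ge0// ler_nat.
- exact: cvg_cst.
- rewrite -[X in _ --> X](mulr0 (m.+1`!%:R)).
  by apply: cvgMl_tmp; exact: cvg_harmonic.
Unshelve. all: by end_near. Qed.

(** The index starts at 2 so that every interval is nondegenerate, as [egamma_trunc_parts]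
    requires. *)
Lemma bigcup_itv_invn {R : realType} :
  \bigcup_n `[(n.+2%:R : R)^-1, n.+2%:R]%classic = `]0, +oo[%classic.
Proof.
apply/seteqP; split=> [u [n _]|u]; rewrite /= !in_itv/= ?andbT.
  by move=> /andP[+ _]; apply: lt_le_trans; rewrite invr_gt0.
move=> u0; exists (Num.truncn u + Num.truncn u^-1)%N => //=.
rewrite in_itv/=; apply/andP; split.
  rewrite -[leRHS]invrK lef_pV2 ?posrE ?invr_gt0//.
  apply: le_trans (ltW (truncnS_gt _)) _.
  by rewrite ler_nat ltnS leqW// leq_addl.
apply: le_trans (ltW (truncnS_gt _)) _.
by rewrite ler_nat ltnS leqW// leq_addr.
Qed.

(** Monotone convergence along this exhaustion; it also covers an infinite limit. *)
Lemma egamma_cvg {R : realType} (x : R) :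
  (\int[@lebesgue_measure R]_(u in `[n.+2%:R^-1%R, n.+2%:R%R])
     (gamma_integrand x u)%:E @[n --> \oo] --> egamma x)%E.
Proof.
rewrite /egamma -bigcup_itv_invn.
apply: ge0_nondecreasing_set_cvg_integral => //.
- move=> m n mn; rewrite subsetEset => u /=; rewrite !in_itv/= => /andP[mu um].
  apply/andP; split.
    by apply: le_trans mu; rewrite lef_pV2 ?posrE// ler_nat.
  by apply: le_trans um _; rewrite ler_nat.
- by move=> n; exact: measurable_gamma_integrand.
- by move=> n u _; rewrite lee_fin gamma_integrand_ge0.
Qed.

(** Limit of [egamma_trunc_parts] along the exhaustion: both boundary terms vanish. Finiteness is
    not yet known here and will be deduced from this identity. *)
Lemma egammaD1 {R : realType} (x : R) : 0 < x ->
  egamma (x + 1) = (x%:E * egamma x)%E.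
Proof.
move=> x0; apply: (cvg_unique _ (egamma_cvg (x + 1))).
  exact: ereal_hausdorff.
rewrite /= -[(_ * _)%E]add0e.
have parts n := @egamma_trunc_parts R x (n.+2%:R)^-1 n.+2%:R x0.
under eq_cvg => n.
  rewrite parts; last 2 first.
  - by rewrite invr_gt0.
  - by rewrite (@lt_trans _ _ 1)// ?invf_lt1 ?ltr1n.
  over.
apply: cvgeD => //; last by apply: cvgeZl => //; exact: egamma_cvg.
apply: cvg_EFin; first exact: nearW.
rewrite -[X in _ --> X](subr0 0); apply: cvgB; last exact: powR_expRN_cvg0.
(* At the lower endpoint [a] the exponential is at most 1, and [a^x] tends to 0 because [x > 0]. *)
apply: (@squeeze_cvgr _ _ _ _ (cst 0) (fun n => (n.+2%:R)^-1 `^ x)).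
- near=> n; rewrite mulr_ge0 ?powR_ge0 ?expR_ge0//=.
  by rewrite ler_piMr ?powR_ge0// -expR0 ler_expR oppr_le0 invr_ge0.
- exact: cvg_cst.
- have h : (n.+2%:R)^-1 @[n --> \oo] --> (0 : R)^'+.
    move=> A [e /= e0 eA].
    have /cvgrPdist_lt/(_ _ e0) := @cvg_harmonic R.
    case=> N _ hN; exists N => //= n Nn.
    have inv0 : 0 < (n.+2%:R : R)^-1 by rewrite invr_gt0.
    by apply: eA => //; exact: (hN n.+1 (leqW Nn)).
  exact: cvg_comp h (powR_cvg0 x0).
Unshelve. all: by end_near. Qed.

(** * Finiteness and positivity of Gamma *)

Lemma egamma_nat_fin {R : realType} (n : nat) : (egamma (n.+1%:R : R) < +oo)%E.
Proof.
elim: n => [|n IH]; first by rewrite egamma1 ltry.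
by rewrite -natr1 egammaD1// lte_mul_pinfty.
Qed.

(* x * egamma x = egamma (x + 1), whose integrand is dominated thanks to
   u^x <= 1 + u^m for a natural number m >= x. *)
Lemma egamma_lty {R : realType} (x : R) : 0 < x -> (egamma x < +oo)%E.
Proof.
move=> x0; suff : (x%:E * egamma x < +oo)%E.
  by rewrite !ltey; apply: contra => /eqP ->; rewrite gt0_muley ?lte_fin.
pose m := (Num.truncn x).+1.
rewrite -egammaD1//; apply: (@le_lt_trans _ _ (egamma 1 + egamma m.+1%:R)%E).
  rewrite /egamma -ge0_integralD//; last 4 first.
  - by move=> u _; rewrite lee_fin gamma_integrand_ge0.
  - exact: measurable_gamma_integrand.
  - by move=> u _; rewrite lee_fin gamma_integrand_ge0.
  - exact: measurable_gamma_integrand.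
  apply: ge0_le_integral => //.
  - by move=> u _; rewrite lee_fin gamma_integrand_ge0.
  - exact: measurable_gamma_integrand.
  - by apply: emeasurable_funD; exact: measurable_gamma_integrand.
  move=> u; rewrite /= in_itv/= andbT => u0.
  rewrite -EFinD lee_fin -mulrDl ler_wpM2r ?expR_ge0//.
  rewrite subrr powRr0 -natr1 !addrK.
  have [u1|u1] := leP u 1.
    rewrite -[leLHS]addr0 lerD ?powR_ge0//.
    have -> : 1 = 1 `^ x :> R by rewrite powR1.
    by rewrite ge0_ler_powR// ?nnegrE ltW.
  rewrite -[leLHS]add0r lerD// ler_powR// ltW//.
  exact: truncnS_gt.
by rewrite egamma1 lte_add_pinfty ?ltry// egamma_nat_fin.
Qed.

(** Passing to [x + 1] makes the exponent of [u] positive, so on [[1, 2]] the integrand is at least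
    [e^(-2)]. *)
Lemma egamma_gt0 {R : realType} (x : R) : 0 < x -> (0 < egamma x)%E.
Proof.
move=> x0; suff : (0 < x%:E * egamma x)%E by rewrite pmule_rgt0.
rewrite -egammaD1//; apply: (@lt_le_trans _ _ (expR (- 2))%:E).
  by rewrite lte_fin expR_gt0.
have -> : (expR (- 2))%:E =
    (\int[@lebesgue_measure R]_(u in `[1%R, 2%R]) (expR (- 2))%:E)%E.
  rewrite integral_cst//= lebesgue_measure_itv/= lte_fin ltr1n.
  by rewrite -EFinB -EFinM; congr _%:E; lra.
apply: (@le_trans _ _ (\int[@lebesgue_measure R]_(u in `[1%R, 2%R])
  (gamma_integrand (x + 1) u)%:E)%E).
  apply: ge0_le_integral => //.
  - exact: measurable_gamma_integrand.
  - move=> u; rewrite /= in_itv/= => /andP[u1 u2].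
    rewrite lee_fin /gamma_integrand addrK -[leLHS]mul1r ler_pM ?expR_ge0//.
      by rewrite -(powRr0 u) ler_powR// ltW.
    by rewrite ler_expR lerN2.
apply: ge0_subset_integral => //.
- exact: measurable_gamma_integrand.
- by move=> u _; rewrite lee_fin gamma_integrand_ge0.
- move=> u; rewrite /= !in_itv/= andbT => /andP[u1 _].
  exact: lt_le_trans u1.
Qed.

Lemma Gamma_gt0 {R : realType} (x : R) : 0 < x -> 0 < Gamma x.
Proof.
by move=> x0; rewrite Gamma_fine// fine_gt0// egamma_gt0// egamma_lty.
Qed.

Lemma GammaD1 {R : realType} (x : R) : 0 < x -> Gamma (x + 1) = x * Gamma x.
Proof.
move=> x0; rewrite !Gamma_fine ?addr_gt0// egammaD1// fineM//.
by rewrite ge0_fin_numE ?egamma_ge0// egamma_lty.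
Qed.

Lemma Gamma1 {R : realType} : Gamma (1 : R) = 1.
Proof. by rewrite Gamma_fine// egamma1. Qed.

(** * Coefficients of the fractional sum *)

(** For [b > 0] this is [Gamma(n + b) / (Gamma(b) n!)], the coefficient of [z^n] in
    [(1 - z)^(-b)]. *)
Definition weight {R : realType} (b : R) (n : nat) : R :=
  (Gamma b)^-1 * rising n.+1%:R (b - 1).

Lemma weight0 {R : realType} (b : R) : 0 < b -> weight b 0 = 1.
Proof.
move=> b0; rewrite /weight /rising Gamma1 divr1 addrC subrK mulVf//.
by rewrite gt_eqF// Gamma_gt0.
Qed.

(** The functional equation is used twice: at [n + b] in the numerator and at [n + 1] in the
    denominator. *)
Lemma weightS {R : realType} (b : R) (n : nat) : 0 < b ->
  weight b n.+1 = weight b n * ((n%:R + b) / n.+1%:R).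
Proof.
move=> b0; have nb : 0 < n%:R + b by rewrite ltr_wpDl.
have n0 : 0 < n.+1%:R :> R by [].
rewrite /weight /rising -[n.+2%:R]natr1 (GammaD1 n.+1%:R n0).
have -> : n.+1%:R + 1 + (b - 1) = n%:R + b + 1 by rewrite -natr1; ring.
have -> : n.+1%:R + (b - 1) = n%:R + b by rewrite -natr1; ring.
rewrite GammaD1//.
by field; rewrite !gt_eqF ?Gamma_gt0.
Qed.

Lemma weight_gt0 {R : realType} (b : R) (n : nat) : 0 < b -> 0 < weight b n.
Proof.
move=> b0; elim: n => [|n IH]; first by rewrite weight0.
by rewrite weightS// mulr_gt0// divr_gt0// ltr_wpDl.
Qed.

Lemma weight_le {R : realType} (b : R) (n : nat) : 0 < b -> b <= 1 ->
  weight b n.+1 <= weight b n.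
Proof.
move=> b0 b1; rewrite weightS//.
apply: ler_piMr; first exact/ltW/weight_gt0.
by rewrite ler_pdivrMr// mul1r -natr1 lerD2l.
Qed.

(** * Fractional sum and difference as weighted sums *)

Lemma nabla_sumE {R : realType} (b : R) (y : nat -> R) (t : nat) :
  nabla_sum (-1) b (on_int y) t%:Z = \sum_(k < t.+1) weight b (t - k) * y k.
Proof.
rewrite /nabla_sum; have -> : t%:Z - (-1) = Posz t.+1 by lia.
rewrite mulr_sumr; apply: eq_bigr => k _ /=.
have -> : -1 + 1 + k%:Z = k by lia.
(* The subtraction in [nat] is exact because [k <= t]. *)
have -> : t%:Z - rho k = (t - k).+1%:Z.
  by rewrite /rho; have := ltn_ord k; lia.
by rewrite mulrA.
Qed.

Lemma nabla_diff0 {R : realType} (nu : R) (y : nat -> R) : nu < 1 ->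
  nabla_diff (-1) nu (on_int y) 0%:Z = y 0%N.
Proof.
move=> nu1; rewrite /nabla_diff /nabla nabla_sumE big_ord1/= subnn.
rewrite weight0 ?subr_gt0// mul1r {1}/nabla_sum.
(* The subtracted sum is taken at the base point -1 itself, so it is empty. *)
have -> : 0%:Z - 1 - (-1) = Posz 0 by lia.
by rewrite big_ord0 mulr0 subr0.
Qed.

(** The terms at [t + 1] and [t] are split off: the former has weight 1, and the latter has weight
    [(1 - nu) - 1 = - nu]. The remaining terms of the two sums are paired. *)
Lemma nabla_diffS {R : realType} (nu : R) (y : nat -> R) (t : nat) : nu < 1 ->
  nabla_diff (-1) nu (on_int y) t.+1%:Z =
  y t.+1 - nu * y t -
  \sum_(k < t) (weight (1 - nu) (t - k) - weight (1 - nu) (t - k).+1) * y k.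
Proof.
move=> nu1; have b0 : 0 < 1 - nu by rewrite subr_gt0.
rewrite /nabla_diff /nabla; have -> : t.+1%:Z - 1 = t by lia.
rewrite !nabla_sumE !big_ord_recr/= !subnn subSn// subnn weightS// weight0//.
under [X in _ = _ - X]eq_bigr do rewrite mulrBl.
rewrite sumrB.
under [X in X + _ + _ - _]eq_bigr => k _.
  rewrite subSn; last exact/ltnW/ltn_ord. over.
by field.
Qed.

Theorem theorem2p11 (R : realType) (y : nat -> R) (nu : R)
    (nu_gt0 : 0 < nu) (nu_lt1 : nu < 1)
    (hy : forall t : nat, 0 <= nabla_diff (-1) nu (on_int y) t%:Z) :
  nu_increasing nu y.
Proof.
have y00 : 0 <= y 0%N by rewrite -(nabla_diff0 nu y)//; exact: hy.
(* Only values strictly before [t] must be nonnegative, so this serves both inside the induction and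
   for the conclusion. *)
have step t : (forall k, (k < t)%N -> 0 <= y k) -> nu * y t <= y t.+1.
  move=> y0; have := hy t.+1; rewrite nabla_diffS// subr_ge0 => sum_le.
  rewrite -subr_ge0; apply: le_trans sum_le; apply: sumr_ge0 => k _.
  apply: mulr_ge0; last exact: y0.
  by rewrite subr_ge0 weight_le// ?subr_gt0// gerBl ltW.
suff y0 : forall t, 0 <= y t by split=> // t; apply: step.
elim/ltn_ind; case=> [//|t] IH.
apply: le_trans (step t _) => [|k kt]; last by apply: IH; exact: ltnW.
by rewrite mulr_ge0 ?IH// ltW.
Qed.
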